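(* Let $A=K[x_1,\dots,x_n]$ be the polynomial $K$-algebra, where $K$ is a UFD of characteristic $p>0$ and $n\geqslant 1$. Put $B=K[x_1^p,\dots,x_n^p]$. Consider arbitrary polynomials $f_1,\dots,f_m\in A$, where $m\geqslant 1$, and denote $R_i=B[f_1,\dots,\widehat{f_i},\dots,f_m]$ and $R_{ij}=B[f_1,\dots,\widehat{f_i},\dots,\widehat{f_j},\dots,f_m]$ for $i\neq j$ (a hat means that the element is omitted). Let $g\in A$ be an irreducible polynomial. Then $\mathrm{dgcd}(f_1,\dots,f_m)$ is divisible by $g$ if and only if at least one of the following conditions holds: (i) $g\notin B$ and $g^2\mid bf_i+c$ for some $i\in\{1,\dots,m\}$ and $b,c\in R_i$ such that $g\nmid b$; (ii) $g\in B$ and $g\mid bf_i+c$ for some $i\in\{1,\dots,m\}$ and $b,c\in R_i$ such that $g\nmid b$; (iii) $g\mid b_1f_i+c_1$ and $g\mid b_2f_j+c_2$ for some $i,j\in\{1,\dots,m\}$, $i\neq j$, and $b_1,b_2,c_1,c_2\in R_{ij}$ such that $g\nmid b_1$ and $g\nmid b_2$.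
   Context: Divisibility is taken in $A$. For $j_1,\dots,j_m\in\{1,\dots,n\}$, $\mathrm{jac}^{f_1,\dots,f_m}_{j_1,\dots,j_m}=\det\left[\frac{\partial f_i}{\partial x_{j_l}}\right]_{1\le i,l\le m}$. The differential gcd is $\mathrm{dgcd}(f_1,\dots,f_m)=\gcd\left(\mathrm{jac}^{f_1,\dots,f_m}_{j_1,\dots,j_m};\ j_1,\dots,j_m\in\{1,\dots,n\}\right)$ (gcd in the UFD $A$), with $\mathrm{dgcd}(f_1,\dots,f_m)=0$ if all these determinants are zero. *)

(* Defs.v *)
From HB Require Import structures.
From mathcomp Require Import all_boot all_order all_algebra.
From mathcomp Require Import mpoly.

Set Implicit Arguments.
Unset Strict Implicit.
Unset Printing Implicit Defensive.

Import GRing.Theory.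
Local Open Scope ring_scope.

Definition divides (R : comNzRingType) (d x : R) : Prop :=
  exists q : R, x = q * d.

Definition irreducible_elt (R : idomainType) (x : R) : Prop :=
  [/\ x != 0, x \isn't a GRing.unit &
      forall a b : R, x = a * b -> a \is a GRing.unit \/ b \is a GRing.unit].

Definition associates (R : idomainType) (x y : R) : Prop :=
  exists2 u : R, u \is a GRing.unit & y = u * x.

(* Every nonzero non-unit is a product of irreducibles, and two such
   factorizations agree up to the order of the factors and up to units. *)
Definition is_UFD (R : idomainType) : Prop :=
  (forall x : R, x != 0 -> x \isn't a GRing.unit ->
     exists2 s : seq R,
       (forall y, y \in s -> irreducible_elt y) & x = \prod_(y <- s) y) /\
  (forall s t : seq R,
     (forall y, y \in s -> irreducible_elt y) ->
     (forall y, y \in t -> irreducible_elt y) ->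
     \prod_(y <- s) y = \prod_(y <- t) y ->
     exists t' : seq R,
       [/\ perm_eq t t', size s = size t' &
           forall k, (k < size s)%N -> associates s`_k t'`_k]).

(* A gcd is only defined up to a unit, hence a relation. If all [F i] vanish,
   the only gcd is 0 (see [is_gcd_all0]). *)
Definition is_gcd (R : comNzRingType) (I : Type) (F : I -> R) (d : R) : Prop :=
  (forall i, divides d (F i)) /\
  (forall e, (forall i, divides e (F i)) -> divides e d).

Lemma is_gcd_all0 (R : comNzRingType) (I : Type) (F : I -> R) (d : R) :
  (forall i, F i = 0) -> is_gcd F d <-> d = 0.
Proof.
move=> F0; split=> [[_ dmax]|->].
  have [q ->] : divides 0 d by apply: dmax => i; exists 0; rewrite F0 mulr0.
  by rewrite mulr0.
by split=> [i|e _]; [exists 0; rewrite F0 mulr0 | exists 0; rewrite mul0r].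
Qed.

(* [adjoin C S] is C[S], the subring generated by the subring C and the set S
   (subrings and subsets are given as predicates). *)
Inductive adjoin (R : comNzRingType) (C S : R -> Prop) : R -> Prop :=
| adjoin_base x : C x -> adjoin C S x
| adjoin_gen x : S x -> adjoin C S x
| adjoin_opp x : adjoin C S x -> adjoin C S (- x)
| adjoin_add x y : adjoin C S x -> adjoin C S y -> adjoin C S (x + y)
| adjoin_mul x y : adjoin C S x -> adjoin C S y -> adjoin C S (x * y).

Section Polynomials.

Variables (K : idomainType) (n : nat).
Local Notation A := {mpoly K[n]}.

Definition subringB (p : nat) : A -> Prop :=
  adjoin (fun h : A => exists c : K, h = c%:MP)
         (fun h : A => exists i : 'I_n, h = 'X_i ^+ p).

Variables (m : nat) (f : 'I_m -> A).

(* The hats omit indices, not values: if f k = f i with k != i, then f i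
   still belongs to [subringR p i]. *)
Definition subringR (p : nat) (i : 'I_m) : A -> Prop :=
  adjoin (subringB p) (fun h : A => exists2 k : 'I_m, k != i & h = f k).

Definition subringR2 (p : nat) (i j : 'I_m) : A -> Prop :=
  adjoin (subringB p)
         (fun h : A => exists2 k : 'I_m, (k != i) && (k != j) & h = f k).

Definition jac (j : 'I_m -> 'I_n) : A :=
  \det (\matrix_(i < m, l < m) (f i)^`M(j l)).

Definition is_dgcd (d : A) : Prop := is_gcd jac d.

End Polynomials.

(* Main.v *)
Require Import Defs.
From HB Require Import structures.
From mathcomp Require Import all_boot all_order all_algebra.
From mathcomp Require Import fingroup perm mpoly ring.
From Stdlib Require Import Classical.

Set Implicit Arguments.
Unset Strict Implicit.
Unset Printing Implicit Defensive.

Import GRing.Theory.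
Local Open Scope ring_scope.

(* By Gauss's lemma g is prime, so everything happens in the field L of fractions of
   A/(g), whose p-th powers lie in the field E generated by B. The B-derivations D of A
   with g | D g ("tangent" below) induce derivations of L over E. If every tangent D that
   kills the elements of S modulo g also kills y, then y lies in E[S] modulo g: removing
   one element h from S, pick a tangent D that kills the rest of S but not h, normalised
   so that D h is a p-th power, and expand y in powers of h by Taylor's formula. For
   empty S and g in B this is Taylor's formula in the variables; if some w = d_i g is
   nonzero modulo g, then w^p y agrees modulo g with -d_i^(p-1) (g^(p-1) w y), which does
   not involve x_i up to p-th powers, and Taylor's formula applies in the other variables.

   The divisibility g | dgcd means that all the minors jac vanish modulo g, hence so does
   det (D_r f_k) for any derivations D_r. Derivations D_i dual to the f_i modulo g would
   contradict this, so some f_i depends on the others: b f_i + c = g h, which gives (ii)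
   if g is in B, and (i) if g | h. Otherwise replace D_i by a partial derivative that does
   not kill g modulo g; the same contradiction shows that some f_j depends on the f_k with
   k <> i, j, and then so does f_i, which is (iii). Conversely, differentiating the
   relations in (i), (ii), (iii) gives a nontrivial linear relation modulo g between the
   gradients of the f_k. *)

(** * Unique factorization in polynomial rings *)

Section Divides.
Variable R : comNzRingType.
Implicit Types g x y : R.

Lemma divides_refl g : divides g g.
Proof. by exists 1; rewrite mul1r. Qed.

Lemma divides0 g : divides g 0.
Proof. by exists 0; rewrite mul0r. Qed.

Lemma dividesMl g x y : divides g y -> divides g (x * y).
Proof. by move=> [q ->]; exists (x * q); rewrite mulrA. Qed.

Lemma dividesMr g x y : divides g x -> divides g (x * y).
Proof. by rewrite mulrC; apply: dividesMl. Qed.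

Lemma dividesD g x y : divides g x -> divides g y -> divides g (x + y).
Proof. by move=> [q ->] [r ->]; exists (q + r); rewrite mulrDl. Qed.

Lemma dividesN g x : divides g x -> divides g (- x).
Proof. by move=> [q ->]; exists (- q); rewrite mulNr. Qed.

Lemma dividesB g x y : divides g x -> divides g y -> divides g (x - y).
Proof. by move=> gx gy; apply: dividesD => //; apply: dividesN. Qed.

Lemma divides_trans g x y : divides g x -> divides x y -> divides g y.
Proof. by move=> gx [q ->]; apply: dividesMl. Qed.

Lemma divides_sum g (I : Type) (r : seq I) (P : pred I) (F : I -> R) :
  (forall i, P i -> divides g (F i)) -> divides g (\sum_(i <- r | P i) F i).
Proof.
move=> gF; elim/big_rec: _ => [|i x Pi gx]; first exact: divides0.
by apply: dividesD => //; apply: gF.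
Qed.

Lemma divides_congr g x y : divides g (x - y) -> divides g x <-> divides g y.
Proof.
move=> gxy; split=> h; last by rewrite -[x](subrK y); apply: dividesD.
by rewrite -[y](subKr x); apply: dividesB.
Qed.

End Divides.

Definition prime_elt (R : idomainType) (x : R) : Prop :=
  [/\ x != 0, x \isn't a GRing.unit &
      forall a b : R, divides x (a * b) -> divides x a \/ divides x b].

(** Factorizations into primes are automatically unique, so existence characterizes unique
    factorization; this form passes to polynomial rings by Gauss's lemma. *)
Definition prime_factorial (R : idomainType) : Prop :=
  forall x : R, x != 0 -> exists u s,
    [/\ u \is a GRing.unit, forall y, y \in s -> prime_elt y
      & x = u * \prod_(y <- s) y].

Lemma divides_unit (R : idomainType) (x u : R) :
  u \is a GRing.unit -> divides x u -> x \is a GRing.unit.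
Proof. by move=> uu [q e]; move: uu; rewrite e unitrM => /andP[]. Qed.

Lemma prime_divides_prod (R : idomainType) (x : R) (s : seq R) :
  prime_elt x -> divides x (\prod_(y <- s) y) -> exists2 y, y \in s & divides x y.
Proof.
move=> [x0 xu xP]; elim: s => [|a s IH].
  by rewrite big_nil => /(divides_unit (unitr1 _)); rewrite (negbTE xu).
rewrite big_cons => /xP[xa|/IH[y ys xy]]; first by exists a; rewrite ?mem_head.
by exists y; rewrite // inE ys orbT.
Qed.

Lemma prime_not_dividesX (R : idomainType) (x y : R) k :
  prime_elt x -> ~ divides x y -> ~ divides x (y ^+ k).
Proof.
move=> [x0 xu xP] xy; elim: k => [|k IH]; first by move/(divides_unit (unitr1 _)); apply/negP.
by rewrite exprS => /xP[].
Qed.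

(** [g] has a prime factor, and by irreducibility the cofactor is a unit. *)
Lemma prime_factorial_irreducible (R : idomainType) (g : R) :
  prime_factorial R -> irreducible_elt g -> prime_elt g.
Proof.
move=> pf [g0 gu girr]; have [u [[|y s] [uu sP e]]] := pf g g0.
  by move: gu; rewrite e big_nil mulr1 uu.
have [y0 yu yP] := sP y (mem_head _ _).
move: e; rewrite big_cons mulrCA => e.
have [yu'|vu] := girr _ _ e; first by rewrite yu' in yu.
split=> // a b gab.
have yg : divides y g by rewrite e; apply/dividesMr/divides_refl.
have gy z : divides y z -> divides g z.
  move=> [q ->]; exists (q / (u * \prod_(z <- s) z)).
  by rewrite e [y * _]mulrC mulrA divrK.
by case: (yP a b (divides_trans yg gab)) => /gy; [left|right].
Qed.

Lemma UFD_irreducible_prime (R : idomainType) (g : R) :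
  is_UFD R -> irreducible_elt g -> prime_elt g.
Proof.
move=> [fact uniq] girr; have [g0 gu _] := girr.
split=> // a b [c e].
have [->|a0] := eqVneq a 0; first by left; apply: divides0.
have [->|b0] := eqVneq b 0; first by right; apply: divides0.
have [au|au] := boolP (a \is a GRing.unit).
  by right; exists (a^-1 * c); rewrite -mulrA -e mulKr.
have [bu|bu] := boolP (b \is a GRing.unit).
  by left; exists (c / b); rewrite mulrAC -e mulrK.
have c0 : c != 0 by apply: contraNneq (mulf_neq0 a0 b0); rewrite e => ->; rewrite mul0r.
have [s sP ea] := fact a a0 au; have [t tP eb] := fact b b0 bu.
have stP y : y \in s ++ t -> irreducible_elt y.
  by rewrite mem_cat => /orP[/sP|/tP].
(* Products in [is_UFD] carry no unit factor, so a unit [c] is absorbed into the irreducible factor: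
   [h] is [g] or [c * g]. *)
have [r [rP er]] : exists r, (forall y, y \in r -> irreducible_elt y) /\
    exists2 h, associates h g & \prod_(y <- s ++ t) y = h * \prod_(y <- r) y
       /\ irreducible_elt h.
  rewrite big_cat /= -ea -eb e.
  have [cu|cu] := boolP (c \is a GRing.unit).
    exists [::]; split=> //; exists (c * g).
      by exists c^-1; rewrite ?unitrV ?mulKr.
    rewrite big_nil mulr1; split=> //; split; first exact: mulf_neq0.
      by rewrite unitrM cu.
    move=> x y exy; case: girr => _ _ /(_ (c^-1 * x) y).
    by rewrite -mulrA -exy mulKr // unitrM unitrV cu /=; apply.
  have [r rP ec] := fact c c0 cu; exists r; split=> //; exists g.
    by exists 1; rewrite ?unitr1 ?mul1r.
  by rewrite -ec mulrC.
case: er => h [v vu ev] [er hirr].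
have [t' [pt st tk]] := uniq (h :: r) (s ++ t)
  (fun y => ltac:(rewrite inE => /orP[/eqP->|/rP] //)) stP
  ltac:(rewrite big_cons er //).
have [w wu ew] := tk 0%N isT.
have st0 : t'`_0 \in s ++ t.
  by rewrite (perm_mem pt) mem_nth // -st.
have gh : divides g h by exists v^-1; rewrite ev mulKr.
have {ew}gt : divides g t'`_0 by rewrite ew; apply: dividesMl.
have gprod q : t'`_0 \in q -> divides g (\prod_(y <- q) y).
  move=> /(perm_to_rem)/(perm_big _) ->; rewrite big_cons.
  exact: dividesMr.
by move: st0; rewrite mem_cat ea eb => /orP[]/gprod; [left|right].
Qed.

Lemma UFD_prime_factorial (R : idomainType) : is_UFD R -> prime_factorial R.
Proof.
move=> ufdR x x0; have [xu|xu] := boolP (x \is a GRing.unit).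
  by exists x, [::]; rewrite big_nil mulr1.
have [s sP ->] := ufdR.1 x x0 xu; exists 1, s; rewrite unitr1 mul1r.
by split=> // y /sP; apply: UFD_irreducible_prime.
Qed.

(** Being inverse to a morphism, [psi] is itself multiplicative, so units and primes correspond
    under [phi]. *)
Lemma bij_prime_factorial (R S : idomainType) (phi : {rmorphism R -> S})
    (psi : S -> R) :
  cancel phi psi -> cancel psi phi -> prime_factorial R -> prime_factorial S.
Proof.
move=> phiK psiK pf.
have psiM : {morph psi : x y / x * y}.
  by move=> x y; apply: (can_inj phiK); rewrite rmorphM !psiK.
have psi0 : psi 0 = 0 by rewrite -(rmorph0 phi) phiK.
have psi1 : psi 1 = 1 by rewrite -(rmorph1 phi) phiK.
have unit_psi x : x \is a GRing.unit -> psi x \is a GRing.unit.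
  by move=> xu; apply/unitrP; exists (psi x^-1); rewrite -!psiM mulVr ?mulrV.
have div_phi x y : divides x y -> divides (phi x) (phi y).
  by move=> [q ->]; exists (phi q); rewrite rmorphM.
have div_psi x y : divides x y -> divides (psi x) (psi y).
  by move=> [q ->]; exists (psi q); rewrite psiM.
move=> x x0; have px0 : psi x != 0.
  by apply: contraNneq x0 => e; rewrite -(psiK x) e rmorph0.
have [u [s [uu sP e]]] := pf _ px0.
exists (phi u), (map phi s); split.
- by rewrite rmorph_unit.
- move=> _ /mapP[y /sP[y0 yu yP] ->]; split.
  + by apply: contraNneq y0 => e'; rewrite -(phiK y) e' psi0.
  + by apply: contra yu => /unit_psi; rewrite phiK.
  + move=> a b /div_psi; rewrite phiK psiM => /yP[]/div_phi; rewrite psiK.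
      by left.
    by right.
- by rewrite -[LHS]psiK e rmorphM rmorph_prod big_map.
Qed.

(** * Gauss's lemma and factorization of univariate polynomials *)

Section Gauss.
Variable R : idomainType.
Implicit Types (p q f : {poly R}) (a c : R).

Lemma divides_polyC a p : divides a%:P p <-> forall i, divides a p`_i.
Proof.
split=> [[q ->] i|ap]; first by exists q`_i; rewrite coefMC.
elim/poly_ind: p ap => [|p c IH] ap; first exact: divides0.
have [|q ->] := IH; first by move=> i; have := ap i.+1; rewrite coefD coefMX coefC addr0.
have [r] := ap 0%N; rewrite coefD coefMX coefC add0r => ->.
by exists (q * 'X + r%:P); rewrite polyCM; ring.
Qed.

(** If [i] and [j] are the least indices of coefficients of [p] and [q] not divisible by [a], the
    coefficient of index [i + j] in the product is congruent modulo [a] to the product of these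
    two. *)
Lemma prime_polyC a : prime_elt a -> prime_elt a%:P.
Proof.
move=> [a0 au aP]; split; first by rewrite polyC_eq0.
  by rewrite poly_unitE size_polyC a0 coefC.
move=> p q; rewrite !divides_polyC => apq.
apply: NNPP => /not_or_and[/not_all_ex_not ap /not_all_ex_not aq].
have least (r : {poly R}) : (exists i, ~ divides a r`_i) ->
    exists2 i, ~ divides a r`_i & forall j, (j < i)%N -> divides a r`_j.
  case=> i; elim/ltn_ind: i => i IH ar.
  have [[j [ji nj]]|h] := classic (exists j, (j < i)%N /\ ~ divides a r`_j).
    exact: (IH j).
  by exists i => // j ji; apply: NNPP => nj; apply: h; exists j.
have {ap}[i ni ip] := least _ ap; have {aq}[j nj jq] := least _ aq.
have ij : (i < (i + j).+1)%N by rewrite ltnS leq_addr.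
have := apq (i + j)%N; rewrite coefM (bigD1 (Ordinal ij)) //= addKn => h.
suff : divides a (p`_i * q`_j) by case/aP.
rewrite -[X in divides a X](addrK (\sum_(k < (i + j).+1 | k != Ordinal ij)
  p`_k * q`_(i + j - k))).
apply: dividesB => //; apply: divides_sum => k kij.
have [ki|ik] := ltnP k i; first exact/dividesMr/ip.
apply/dividesMl/jq; rewrite ltn_subLR; last by rewrite -ltnS ltn_ord.
rewrite ltn_add2r.
by rewrite ltn_neqAle ik andbT eq_sym.
Qed.

Definition primitive f := forall a, prime_elt a -> ~ divides a%:P f.

Hypothesis pfR : prime_factorial R.

(** The primes of [c] cancel one by one: each divides the product of [f] and the quotient, hence the
    quotient, as it cannot divide the primitive [f]. *)
Lemma primitive_divides c f h : c != 0 -> primitive f ->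
  divides f (c *: h) -> divides f h.
Proof.
move=> /pfR[u [s [uu sP ->]]] fprim; elim: s sP h => [|a s IH] sP h.
  rewrite big_nil mulr1 => [[q e]]; exists (u^-1 *: q).
  by rewrite -scalerAl -e scalerA mulVr ?scale1r.
have [a0 _ _] := sP a (mem_head _ _).
rewrite big_cons mulrCA -scalerA => [[q e]].
have /prime_polyC[_ _ aP] := sP a (mem_head _ _).
have [|[r er]|/fprim] := aP q f.
- by rewrite -e -mul_polyC; apply/dividesMr/divides_refl.
- apply: IH; first by move=> y ys; apply: sP; rewrite inE ys orbT.
  exists r; apply: (mulfI (x := a%:P)); first by rewrite polyC_eq0.
  by rewrite mul_polyC e er; ring.
- by case; apply: sP; rewrite mem_head.
Qed.

(** Induction on the number of prime factors of the leading coefficient, which drops when a prime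
    constant is divided out. *)
Lemma content_primitive f : f != 0 ->
  exists c f1, [/\ c != 0, primitive f1 & f = c *: f1].
Proof.
move=> f0; have [u [s [uu sP e]]] := pfR (x := lead_coef f) ltac:(by rewrite lead_coef_eq0).
have [k] := ubnP (size s); elim: k => // k IH in f f0 u s uu sP e *.
rewrite ltnS => sk.
have [|] := classic (primitive f).
  by exists 1, f; rewrite oner_eq0 scale1r.
move=> /not_all_ex_not[a na].
have [aprim /NNPP[q eq]] := imply_to_and _ _ na.
have [a0 au aP] := aprim.
have q0 : q != 0 by apply: contraNneq f0; rewrite eq => ->; rewrite mul0r.
have := e; rewrite eq lead_coefM lead_coefC => eqs.
have [|/(divides_unit uu)|/(prime_divides_prod aprim)[b bs [v eb]]] :=
    aP u (\prod_(y <- s) y).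
- by exists (lead_coef q); rewrite -eqs.
- by rewrite (negbTE au).
have [b0 bu bP] := sP b bs.
(* [a] divides the prime [b], so the two are associates and [b] can be removed from the
   factorization. *)
have vu : v \is a GRing.unit.
  have : divides b (v * a) by exists 1; rewrite mul1r eb.
  case/bP=> [[w ew]|[w ew]].
    move: eb; rewrite ew mulrAC -[LHS]mul1r => /(mulIf b0)/esym wa.
    by case/negP: au; apply/unitrPr; exists w; rewrite mulrC.
  move: ew; rewrite eb mulrA -[LHS]mul1r => /(mulIf a0)/esym wv.
  by apply/unitrPr; exists w; rewrite mulrC.
have [||||c [f1 [c0 f1P eqf]]] := IH q q0 (u * v) (rem b s).
- by rewrite unitrM uu.
- by move=> y /mem_rem; apply: sP.
- apply: (mulIf a0); rewrite eqs (perm_big _ (perm_to_rem bs)) big_cons {1}eb /=.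
  by ring.
- by apply: leq_trans sk; rewrite size_rem // prednK // -has_predT; apply/hasP; exists b.
exists (c * a), f1; split=> //; first exact: mulf_neq0.
by rewrite eqf mulrC mul_polyC scalerA mulrC.
Qed.

(** [%|] is divisibility up to a nonzero constant, that is, over the fraction field;
    [primitive_divides] removes the constant. *)
Lemma primitive_dvdp f h : primitive f -> divides f h <-> (f %| h).
Proof.
move=> fprim; split=> [[q ->]|/Pdiv.Idomain.dvdpP[[c q] /= c0 e]].
  by apply/Pdiv.Idomain.dvdpP; exists (1, q); rewrite /= ?oner_eq0 ?scale1r.
by apply: (primitive_divides c0 fprim); rewrite e; apply/dividesMl/divides_refl.
Qed.

(** Over the fraction field [f] either is coprime to [p], hence divides [q], or divides [p]. *)
Lemma irreducible_poly_prime f : primitive f -> irreducible_poly f -> prime_elt f.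
Proof.
move=> fprim [sf firr]; split; first by rewrite -size_poly_gt0 ltnW.
  by rewrite poly_unitE; case: eqP sf => // ->.
move=> p q; rewrite !primitive_dvdp // => fpq.
have [sg|sg] := eqVneq (size (gcdp f p)) 1.
  by right; rewrite -(@Gauss_dvdpr _ q p f) // coprimep_def sg.
by left; rewrite -(eqp_dvdl _ (firr _ sg (dvdp_gcdl f p))) dvdp_gcdr.
Qed.

(** Induction on the size. The content factors in [R]; a primitive part reducible over the fraction
    field splits over [R] once its factor is made primitive. *)
Lemma poly_prime_factorial : prime_factorial {poly R}.
Proof.
pose P f := exists u s, [/\ u \is a GRing.unit, forall y, y \in s -> prime_elt y
  & f = u * \prod_(y <- s) y].
have PM p q : P p -> P q -> P (p * q).
  move=> [u [s [uu sP ->]]] [v [t [vu tP ->]]]; exists (u * v), (s ++ t); split.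
  - by rewrite unitrM uu.
  - by move=> y; rewrite mem_cat => /orP[/sP|/tP].
  - by rewrite big_cat /=; ring.
have PC c : c != 0 -> P c%:P.
  move=> /pfR[u [s [uu sP ->]]]; exists u%:P, [seq a%:P | a <- s]; split.
  - exact: rmorph_unit.
  - by move=> _ /mapP[y /sP/prime_polyC yP ->].
  - by rewrite rmorphM rmorph_prod big_map.
move=> f; have [k] := ubnP (size f); elim: k f => // k IH f.
rewrite ltnS => fk f0.
have [c [h [c0 hprim ef]]] := content_primitive f0.
have sh : size h = size f by rewrite ef size_scale.
rewrite ef -mul_polyC; apply: (PM _ _ (PC _ c0)).
have h0 : h != 0 by rewrite -size_poly_gt0 sh size_poly_gt0.
have [sh1|sh1] := leqP (size h) 1.
  by rewrite (size1_polyC sh1); apply: PC; rewrite -polyC_eq0 -size1_polyC.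
have [hirr|hred] := classic (irreducible_poly h).
  exists 1, [:: h]; rewrite unitr1 big_seq1 mul1r; split=> // y.
  by rewrite inE => /eqP->; apply: irreducible_poly_prime.
have [q [sq qh nqh]] : exists q, [/\ size q != 1, q %| h & ~~ (q %= h)].
  apply: NNPP => nq; apply: hred; split=> // q sq qh.
  by apply/negPn/negP => nqh; apply: nq; exists q.
have q0 : q != 0 by apply: contraTneq qh => ->; rewrite dvd0p.
have [a [q1 [a0 q1prim eq]]] := content_primitive q0.
have sq1 : size q1 = size q by rewrite eq size_scale.
have q10 : q1 != 0 by rewrite -size_poly_gt0 sq1 size_poly_gt0.
have : q1 %| h by rewrite -(dvdpZl _ _ a0) -eq.
rewrite -(primitive_dvdp _ q1prim) => [[r er]].
have r0 : r != 0 by apply: contraNneq h0 => r0; rewrite er r0 mul0r.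
have q1h : (size q1 < size h)%N.
  by rewrite sq1 ltn_neqAle (dvdp_size_eqp qh) nqh dvdp_leq.
have q1gt1 : (1 < size q1)%N by rewrite ltn_neqAle eq_sym size_poly_gt0 q10 sq1 sq.
have rh : (size r < size h)%N.
  rewrite er size_mul //; case: (size q1) q1gt1 => [|[|j]] // _.
  by rewrite !addnS ltnS leq_addr.
by rewrite er; apply: PM; apply: IH => //; apply: leq_trans fk; rewrite -sh.
Qed.

End Gauss.

Lemma mpoly_ind_gen (R : nzRingType) n (P : {mpoly R[n]} -> Prop) :
  (forall c, P c%:MP) -> (forall i, P 'X_i) ->
  (forall p q, P p -> P q -> P (p + q)) -> (forall p q, P p -> P q -> P (p * q)) ->
  forall p, P p.
Proof.
move=> PC PX PD PM p; rewrite [p]mpolyE; elim/big_rec: _ => [|m q _ Pq].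
  by rewrite -mpolyC0.
apply: PD => //; rewrite -mul_mpolyC; apply: (PM) => //.
rewrite mpolyXE_id; elim/big_rec: _ => [|i r _ Pr]; first by rewrite -mpolyC1.
apply: (PM) => //; elim: (m i) => [|k IH]; first by rewrite expr0 -mpolyC1.
by rewrite exprS; apply: PM.
Qed.

(** Induction on [n], reading a polynomial in [n.+1] variables as a univariate one in the last
    variable. *)
Lemma mpoly_prime_factorial (R : idomainType) n :
  prime_factorial R -> prime_factorial {mpoly R[n]}.
Proof.
move=> pfR; elim: n => [|n IH].
  apply: (bij_prime_factorial (phi := @mpolyC 0 R) (psi := mcoeff 0%MM)) => // [c|p].
    by rewrite mcoeffC eqxx mulr1.
  by elim/mpoly_ind_gen: p => [c|[]|p q ep eq|p q ep eq] //;
    rewrite ?mcoeffC ?eqxx ?mulr1 // (rmorphD, rmorphM) /= (rmorphD, rmorphM) /= ep eq.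
have [psi [psiC psiX]] : exists psi : {rmorphism {poly {mpoly R[n]}} -> {mpoly R[n.+1]}},
    (forall c, psi c%:P = mwiden c) /\ psi 'X = 'X_ord_max.
  exists (horner_eval ('X_ord_max : {mpoly R[n.+1]}) \o map_poly (@mwiden n R)).
  by split=> [c|] /=; rewrite ?map_polyC ?map_polyX /horner_eval ?hornerC ?hornerX.
have psiD x y : psi (x + y) = psi x + psi y by rewrite rmorphD.
have psiM x y : psi (x * y) = psi x * psi y by rewrite rmorphM.
have [phi [phiC phiX phiXmax phiD phiM]] : exists phi : {mpoly R[n.+1]} -> {poly {mpoly R[n]}},
    [/\ forall c, phi c%:MP = c%:MP%:P,
        forall i, phi 'X_(widen_ord (leqnSn n) i) = ('X_i)%:P, phi 'X_ord_max = 'X,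
        {morph phi : x y / x + y} & {morph phi : x y / x * y}].
  exists (@muni n R); split; [exact: muniC| | |exact: muniD|exact: muniM].
  - move=> i; rewrite muniE msuppX big_seq1 mcoeffX eqxx scale1r mnm1E.
    rewrite -val_eqE /= ltn_eqF // expr0 alg_polyC; congr ('X_[_])%:P.
    by apply/mnmP=> j; rewrite mnmE !mnm1E -val_eqE.
  - rewrite muniE msuppX big_seq1 mcoeffX eqxx scale1r mnm1E eqxx expr1.
    rewrite [X in 'X_[X]](_ : _ = 0%MM) ?mpolyX0 ?scale1r //.
    by apply/mnmP=> j; rewrite mnmE mnm1E mnm0E -val_eqE /= gtn_eqF.
apply: (bij_prime_factorial (phi := psi) (psi := phi)) (poly_prime_factorial IH).
- move=> p; elim/poly_ind: p => [|p c ep].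
    by rewrite rmorph0 -mpolyC0 phiC mpolyC0 polyC0.
  rewrite psiD psiM phiD phiM ep psiX psiC phiXmax; congr (_ + _).
  elim/mpoly_ind_gen: c {p ep} => [c|i|p q ep eq|p q ep eq].
  + by rewrite mwidenC phiC.
  + by rewrite mwidenX mnmwiden1 phiX.
  + by rewrite mwidenD phiD polyCD ep eq.
  + by rewrite mwidenM phiM polyCM ep eq.
- move=> p; elim/mpoly_ind_gen: p => [c|i|p q ep eq|p q ep eq].
  + by rewrite phiC psiC mwidenC.
  + have [j ->|->] := unliftP ord_max i; last by rewrite phiXmax psiX.
    have -> : lift ord_max j = widen_ord (leqnSn n) j.
      by apply/val_inj; rewrite /= /bump leqNgt ltn_ord.
    by rewrite phiX psiC mwidenX mnmwiden1.
  + by rewrite phiD psiD ep eq.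
  + by rewrite phiM psiM ep eq.
Qed.

(** * Derivations modulo a prime *)

Lemma adjoin_mono (R : comNzRingType) (C S S' : R -> Prop) x :
  (forall y, S y -> adjoin C S' y) -> adjoin C S x -> adjoin C S' x.
Proof.
move=> SS'; elim=> {x}.
- by move=> x Cx; apply: adjoin_base.
- exact: SS'.
- by move=> x _; apply: adjoin_opp.
- by move=> x y _ ? _ ?; apply: adjoin_add.
- by move=> x y _ ? _ ?; apply: adjoin_mul.
Qed.

(** Taylor's formula below order p divides by k!; a Bézout relation with p inverts each factor. *)
Lemma fact_unit (R : comUnitRingType) p k :
  p \in [pchar R] -> (k < p)%N -> (k`!)%:R \is a @GRing.unit R.
Proof.
move=> pR kp; have p_pr := pcharf_prime pR.
elim: k kp => [|k IH] kp; first by rewrite unitr1.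
rewrite factS natrM unitrM IH ?andbT; last exact: ltnW.
have : coprime k.+1 p by rewrite coprime_sym prime_coprime // gtnNdvd.
have [u v uv _] := egcdnP p (ltn0Sn k); rewrite /coprime => /eqP e.
apply/unitrPr; exists u%:R.
by rewrite -natrM mulnC uv e natrD natrM (pcharf0 pR) mulr0 add0r.
Qed.

Section Derivations.
Variables (A : idomainType) (B : A -> Prop).
Implicit Types (D E : A -> A) (a b c x y z g w : A).

Definition derivation D :=
  [/\ {morph D : x y / x + y}, forall x y, D (x * y) = x * D y + y * D x
    & forall b, B b -> D b = 0].

Lemma derivation0 D : derivation D -> D 0 = 0.
Proof. by case=> DD _ _; apply: (addrI (D 0)); rewrite -DD !addr0. Qed.

Lemma derivationN D : derivation D -> {morph D : x / - x}.
Proof.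
by move=> dD x; apply: (addrI (D x)); case: (dD) => DD _ _;
  rewrite -DD !subrr derivation0.
Qed.

Lemma derivationB D : derivation D -> {morph D : x y / x - y}.
Proof. by move=> dD x y; case: (dD) => -> _ _; rewrite derivationN. Qed.

Lemma derivationMn D : derivation D -> forall x k, D (x *+ k) = D x *+ k.
Proof.
move=> dD x; elim=> [|k IH]; first by rewrite derivation0.
by rewrite !mulrS; case: (dD) => -> _ _; rewrite IH.
Qed.

Lemma derivation_sum D : derivation D ->
  forall (I : Type) (r : seq I) (P : pred I) (F : I -> A),
  D (\sum_(i <- r | P i) F i) = \sum_(i <- r | P i) D (F i).
Proof.
by move=> dD I r P F; apply: (big_morph D); [case: dD | apply: derivation0].
Qed.

Lemma derivationXn D : derivation D ->
  forall x k, D (x ^+ k) = k%:R * x ^+ k.-1 * D x.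
Proof.
move=> dD x; elim=> [|k IH].
  rewrite expr0 !mul0r; case: (dD) => _ DM _.
  by have := DM 1 1; rewrite !mul1r => /eqP; rewrite addrC -subr_eq subrr => /eqP.
rewrite exprS; case: (dD) => _ -> _; rewrite IH.
case: k {IH} => [|k] /=; first by rewrite expr0 mul0r; ring.
by rewrite exprS; ring.
Qed.

Lemma iter_derivationD D k : derivation D -> {morph iter k D : x y / x + y}.
Proof. by move=> [DD _ _]; elim: k => // k IH x y; rewrite /= IH DD. Qed.

Lemma derivation_lin a D b E : derivation D -> derivation E ->
  derivation (fun x => a * D x + b * E x).
Proof.
move=> [DD DM DB] [ED EM EB]; split=> [x y|x y|c Bc].
- by rewrite DD ED; ring.
- by rewrite DM EM; ring.
- by rewrite DB ?EB // !mulr0 addr0.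
Qed.

Lemma derivation_bracket D E : derivation D -> derivation E ->
  derivation (fun x => D (E x) - E (D x)).
Proof.
move=> dD dE; case: (dD) => [DD DM DB]; case: (dE) => [ED EM EB]; split=> [x y|x y|c Bc].
- by rewrite DD ED DD ED; ring.
- by rewrite DM EM DD ED !DM !EM; ring.
- by rewrite (DB c Bc) (EB c Bc) (derivation0 dD) (derivation0 dE) subr0.
Qed.

Lemma Leibniz_iter D : derivation D -> forall k x y,
  iter k D (x * y) =
  \sum_(i < k.+1) (iter (k - i) D x * iter i D y) *+ 'C(k, i).
Proof.
move=> dD; elim=> [|k IH] x y; first by rewrite big_ord1 bin0.
case: (dD) => DD DM _.
rewrite iterS IH (derivation_sum dD).
under eq_bigr => i _ do rewrite (derivationMn dD) DM mulrnDl.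
rewrite big_split /= [RHS]big_ord_recl /= ?subn0 bin0 [X in _ + X]big_ord_recl /=.
rewrite ?subn0 bin0 mulr1n [y * _]mulrC addrCA; congr (_ + _).
under [RHS]eq_bigr => i _ do rewrite /bump /= add1n subSS binS mulrnDr addrC.
rewrite [RHS]big_split /=; congr (_ + _).
rewrite [RHS]big_ord_recr /= bin_small // mulr0n addr0.
apply: eq_bigr => i _; rewrite /bump /= add1n mulrC -iterS.
by rewrite subnSK.
Qed.

Variables (p : nat) (charA : p \in [pchar A]).

(** In the Leibniz formula of order p the middle binomial coefficients vanish, so only the two end
    terms survive. *)
Lemma derivation_iter_char D : derivation D -> derivation (iter p D).
Proof.
move=> dD; have p_pr := pcharf_prime charA.
split=> [|x y|b Bb]; first exact: iter_derivationD.
- rewrite Leibniz_iter //; case: p charA p_pr => // q chA q_pr.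
  rewrite big_ord_recl big_ord_recr /= big1 => [|i _].
    by rewrite bin0 binn subnn add0r !mulr1n /=; ring.
  have /eqP C0 : 'C(q.+1, bump 0 i)%:R == 0 :> A.
    by rewrite -(dvdn_pcharf chA) prime_dvd_bin //= /bump add1n ltnS.
  by rewrite -mulr_natr C0 mulr0.
- by case: p p_pr => // q _; rewrite iterSr; case: (dD) => _ _ ->;
    last done; elim: q => //= q ->; apply: derivation0.
Qed.

Definition tangent g D := derivation D /\ divides g (D g).

Lemma tangent_divides g D x : tangent g D -> divides g x -> divides g (D x).
Proof.
move=> [[_ DM _] Dg] [q ->]; rewrite DM; apply: dividesD; first exact: dividesMl.
exact/dividesMr/divides_refl.
Qed.

Lemma tangent_iter_divides g D k x :
  tangent g D -> divides g x -> divides g (iter k D x).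
Proof. by move=> tD; elim: k => //= k IH /IH; apply: tangent_divides. Qed.

Lemma tangent_lin g a D b E : tangent g D -> tangent g E ->
  tangent g (fun x => a * D x + b * E x).
Proof.
move=> [dD Dg] [dE Eg]; split; first exact: derivation_lin.
by apply: dividesD; apply: dividesMl.
Qed.

Lemma tangent_bracket g D E : tangent g D -> tangent g E ->
  tangent g (fun x => D (E x) - E (D x)).
Proof.
move=> tD tE; split; first by apply: derivation_bracket; [case: tD|case: tE].
by apply: dividesB; apply: tangent_divides => //; [case: tE|case: tD].
Qed.

Lemma tangent_iter_char g D : tangent g D -> tangent g (iter p D).
Proof.
move=> tD; split; first by apply: derivation_iter_char; case: tD.
by apply: tangent_iter_divides => //; apply: divides_refl.
Qed.

(** Modulo [g], [D] treats [c] and [w] as constants and sends [f] to [w], as if it were [w] times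
    the derivative in [f]. *)
Lemma iter_derivation_power g D k f w c : tangent g D -> D w = 0 ->
  divides g (D f - w) -> divides g (D c) ->
  divides g (iter k D (f ^+ k * c) - (k`!)%:R * w ^+ k * c).
Proof.
move=> tD Dw Df; have [dD _] := tD; have [DD DM _] := dD.
elim: k c => [|k IH] c Dc; first by rewrite /= !mul1r subrr; apply: divides0.
have Dc' : divides g (D (k.+1%:R * (w * c))).
  by rewrite mulr_natl derivationMn // DM Dw mulr0 addr0 -mulr_natr; apply/dividesMr/dividesMl.
have := IH _ Dc'; apply: (iffLR (divides_congr _)).
pose r := f ^+ k.+1 * D c + c * k.+1%:R * f ^+ k * (D f - w).
have gr : divides g r by apply: dividesD; apply: dividesMl.
rewrite iterSr [D (_ * c)](_ : _ = f ^+ k * (k.+1%:R * (w * c)) + r); last first.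
  by rewrite DM (derivationXn dD) /r /=; ring.
rewrite iter_derivationD // [X in divides g X](_ : _ = - iter k D r).
  exact/dividesN/tangent_iter_divides.
by rewrite factS natrM exprS; ring.
Qed.

(** A term of the expansion escapes divisibility by [g] only if the k derivations hit the k factors
    [g] once each, in one of k! orders. *)
Lemma iter_derivation_top D k g z : derivation D ->
  divides g (iter k D (g ^+ k * z) - (k`!)%:R * D g ^+ k * z).
Proof.
move=> dD; have [DD DM _] := dD.
elim: k z => [|k IH] z; first by rewrite /= !mul1r subrr; apply: divides0.
rewrite iterSr.
have -> : D (g ^+ k.+1 * z) = g ^+ k * (k.+1%:R * D g * z + g * D z).
  by rewrite DM (derivationXn dD) /= exprS; ring.
have := IH (k.+1%:R * D g * z + g * D z); move: (iter k D _) => t.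
apply: (iffLR (divides_congr _)); exists (- (k`!%:R * D g ^+ k * D z)).
by rewrite factS natrM exprS; ring.
Qed.

(** * A differential criterion for membership in a field generated modulo g *)

Section Closure.
Hypotheses (B1 : B 1) (BD : forall x y, B x -> B y -> B (x + y))
  (BN : forall x, B x -> B (- x)) (BM : forall x y, B x -> B y -> B (x * y))
  (Bp : forall x, B (x ^+ p)).
Variables (g : A) (g_prime : prime_elt g).
Implicit Types (S : seq A).

Definition tangent_const S y := forall D, tangent g D ->
  (forall h, h \in S -> divides g (D h)) -> divides g (D y).

(* Modulo [g], [y] lies in the field generated by [B] and [S]; denominators in [B] suffice
   because every p-th power is in [B]. *)
Definition frac_adjoin S y := exists b c,
  [/\ B b, ~ divides g b, adjoin B (fun h => h \in S) c & divides g (b * y - c)].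

Lemma prime_notdividesM x y : ~ divides g x -> ~ divides g y -> ~ divides g (x * y).
Proof. by move=> gx gy; case: g_prime => _ _ gP /gP[]. Qed.

Lemma unit_notdivides u : u \is a GRing.unit -> ~ divides g u.
Proof. by move=> uu /(divides_unit uu); apply/negP; case: g_prime. Qed.

Lemma B0 : B 0. Proof. by rewrite -(subrr 1); apply/BD/BN. Qed.

Lemma Bnat k : B k%:R.
Proof. by elim: k => [|k IH]; [apply: B0 | rewrite mulrS; apply: BD]. Qed.

Lemma BX x k : B x -> B (x ^+ k).
Proof. by move=> Bx; elim: k => // k IH; rewrite exprS; apply: BM. Qed.

Lemma frac_adjoin_base S x : B x -> frac_adjoin S x.
Proof.
move=> Bx; exists 1, x; split=> //; first exact/unit_notdivides/unitr1.
  exact: adjoin_base.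
by rewrite mul1r subrr; apply: divides0.
Qed.

Lemma frac_adjoin_gen S x : x \in S -> frac_adjoin S x.
Proof.
move=> Sx; exists 1, x; split=> //; first exact/unit_notdivides/unitr1.
  exact: adjoin_gen.
by rewrite mul1r subrr; apply: divides0.
Qed.

Lemma frac_adjoin_sub S S' x : {subset S <= S'} ->
  frac_adjoin S x -> frac_adjoin S' x.
Proof.
move=> SS' [b [c [Bb gb Sc e]]]; exists b, c; split=> //.
by apply: adjoin_mono Sc => y /SS' yS'; apply adjoin_gen.
Qed.

Lemma frac_adjoin_congr S x y : divides g (x - y) ->
  frac_adjoin S x -> frac_adjoin S y.
Proof.
move=> gxy [b [c [Bb gb Sc e]]]; exists b, c; split=> //.
rewrite (_ : _ - _ = (b * x - c) - b * (x - y)); last by ring.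
by apply/dividesB/dividesMl.
Qed.

Lemma frac_adjoinD S x y : frac_adjoin S x -> frac_adjoin S y -> frac_adjoin S (x + y).
Proof.
move=> [b [c [Bb gb Sc e]]] [b' [c' [Bb' gb' Sc' e']]].
exists (b * b'), (b' * c + b * c'); split; first exact: BM.
- exact: prime_notdividesM.
- by apply: adjoin_add; apply: adjoin_mul => //; apply: adjoin_base.
- rewrite (_ : _ - _ = b' * (b * x - c) + b * (b' * y - c')); last by ring.
  by apply: dividesD; apply: dividesMl.
Qed.

Lemma frac_adjoinM S x y : frac_adjoin S x -> frac_adjoin S y -> frac_adjoin S (x * y).
Proof.
move=> [b [c [Bb gb Sc e]]] [b' [c' [Bb' gb' Sc' e']]].
exists (b * b'), (c * c'); split; first exact: BM.
- exact: prime_notdividesM.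
- exact: adjoin_mul.
- rewrite (_ : _ - _ = (b' * y) * (b * x - c) + c * (b' * y - c')); last by ring.
  by apply: dividesD; apply: dividesMl.
Qed.

Lemma frac_adjoinX S x k : frac_adjoin S x -> frac_adjoin S (x ^+ k).
Proof.
move=> Sx; elim: k => [|k IH]; first exact: frac_adjoin_base.
by rewrite exprS; apply: frac_adjoinM.
Qed.

Lemma frac_adjoin_cancel S b x : B b -> ~ divides g b ->
  frac_adjoin S (b * x) -> frac_adjoin S x.
Proof.
move=> Bb gb [b' [c [Bb' gb' Sc e]]]; exists (b' * b), c; split=> //.
- exact: BM.
- exact: prime_notdividesM.
- by rewrite -mulrA.
Qed.

(** E (D y) is D (E y) plus the bracket of E and D applied to y, and this bracket kills [S] modulo
    [g]. *)
Lemma tangent_const_iter S D y : tangent g D ->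
  (forall h E, h \in S -> tangent g E -> (forall h, h \in S -> divides g (E h)) ->
      divides g (E (D h))) ->
  tangent_const S y -> tangent_const S (D y).
Proof.
move=> tD SD yS E tE ES.
rewrite -[E (D y)](subrK (D (E y))); apply: dividesD.
  apply: (yS (fun x => E (D x) - D (E x))); first exact: tangent_bracket.
  move=> h hS; apply: dividesB; first exact: SD.
  by apply: tangent_divides => //; apply: ES.
by apply: tangent_divides => //; apply: yS.
Qed.

(* [D] behaves as a partial derivative with respect to [h], and the degree of [y]
   in [h] is lowered one step at a time. *)
Lemma frac_adjoin_taylor S h D w k y :
  (forall y, tangent_const S y -> frac_adjoin S y) ->
  tangent g D -> (forall x, x \in S -> divides g (D x)) ->
  B w -> ~ divides g w -> divides g (D h - w) ->
  (k <= p)%N -> tangent_const (h :: S) y -> divides g (iter k D y) ->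
  frac_adjoin (h :: S) y.
Proof.
move=> IHS tD DS Bw gw Dh; have [dD _] := tD; have [DD DM DB] := dD.
have sub : {subset S <= h :: S} by move=> x xS; rewrite inE xS orbT.
elim: k y => [|k IH] y kp yS Dy.
  apply: (frac_adjoin_congr (x := 0)); last exact/frac_adjoin_base/B0.
  by rewrite sub0r; apply: dividesN.
set c := iter k D y.
have cS : tangent_const (h :: S) c.
  rewrite /c; elim: (k) => //= l; apply: tangent_const_iter => //.
  move=> x E; rewrite inE => /orP[/eqP->|xS] tE ES.
    rewrite -[D h](subrK w); have [[ED _ EB] _] := tE.
    by rewrite ED (EB w Bw) addr0; apply: tangent_divides.
  by apply: tangent_divides => //; apply: DS.
have Dc : divides g (D c) by [].
(* If [E] kills [S] modulo [g], then w E - (E h) D kills [h] as well, hence [c]; since [D] kills [c]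
   too, so does [E]. *)
have cadj : frac_adjoin S c.
  apply: IHS => E tE ES.
  have : divides g (w * E c + (- E h) * D c).
    apply: (cS (fun x => w * E x + (- E h) * D x)); first exact: tangent_lin.
    move=> x; rewrite inE => /orP[/eqP->|xS].
      rewrite (_ : _ + _ = (- E h) * (D h - w)); last by ring.
      exact: dividesMl.
    by apply: dividesD; apply: dividesMl; [apply: ES | apply: DS].
  move=> /dividesB/(_ (dividesMl (- E h) Dc)); rewrite addrK.
  by case: g_prime => _ _ gP /gP[].
have u := fact_unit charA kp.
(* The top term of [y] in powers of [h] is h^k c / t; removing it from [t * y] leaves an element
   whose k-th iterate under [D] vanishes modulo [g]. *)
pose t := k`!%:R * w ^+ k.
have Bt : B t by apply: BM; [apply: Bnat | apply: BX].
have gt : ~ divides g t.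
  by apply: prime_notdividesM; [apply: unit_notdivides | apply: prime_not_dividesX].
apply: (frac_adjoin_cancel Bt gt).
rewrite -[t * y](subrK (h ^+ k * c)); apply: frac_adjoinD; last first.
  apply: frac_adjoinM; last exact: frac_adjoin_sub cadj.
  by apply/frac_adjoinX/frac_adjoin_gen; rewrite mem_head.
apply: IH; first exact: ltnW.
- move=> E tE ES; have [dE _] := tE; have [ED EM EB] := dE.
  rewrite derivationB // (EM t) (EB t Bt) EM mulr0 addr0.
  apply: dividesB; first by apply/dividesMl/yS.
  apply: dividesD; apply: dividesMl; first exact: cS.
  rewrite (derivationXn dE); apply/dividesMl/ES.
  exact: mem_head.
- have tconst z : iter k D (t * z) = t * iter k D z.
    by elim: (k) => //= l ->; rewrite DM (DB t Bt) mulr0 addr0.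
  have iterB x z : iter k D (x - z) = iter k D x - iter k D z.
    by elim: (k) => //= l ->; rewrite derivationB.
  rewrite iterB tconst -opprB.
  by apply/dividesN/iter_derivation_power => //; apply: DB.
Qed.

Lemma tangent_const_frac_adjoin S y :
  (forall y, tangent_const [::] y -> frac_adjoin [::] y) ->
  tangent_const S y -> frac_adjoin S y.
Proof.
move=> base; elim: S y => [|h S IH] y yS; first exact: base.
have sub : {subset S <= h :: S} by move=> x xS; rewrite inE xS orbT.
have [[D [tD DS gDh]]|noD] := classic (exists D, [/\ tangent g D,
   forall x, x \in S -> divides g (D x) & ~ divides g (D h)]); last first.
  apply: frac_adjoin_sub (IH _ _) => // D tD DS; apply: yS => // x.
  rewrite inE => /orP[/eqP->|/DS//].
  by apply: NNPP => gDh; apply: noD; exists D.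
(* The factor makes [D1 h] a p-th power, so an element of [B]; the zero summand gives the shape of
   [tangent_lin]. *)
pose D1 x := D h ^+ p.-1 * D x + 0 * D x.
have tD1 : tangent g D1 by apply: tangent_lin.
have p_pr := pcharf_prime charA.
have D1S x : x \in S -> divides g (D1 x).
  by move=> /DS gx; rewrite /D1 mul0r addr0; apply: dividesMl.
have D1h : D1 h = D h ^+ p.
  by rewrite /D1 mul0r addr0 -exprSr prednK // prime_gt0.
apply: (@frac_adjoin_taylor S h D1 _ p y IH tD1 D1S (Bp (D h))) => //.
- exact: prime_not_dividesX.
- by rewrite D1h subrr; apply: divides0.
(* As [D1 h] lies in [B] and p is at least 2, the p-th iterate kills [h], hence also [y] modulo [g]:
   the expansion stops below degree p. *)
- apply: (yS (iter p D1)); first exact: tangent_iter_char.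
  move=> x; rewrite inE => /orP[/eqP->|/D1S gx].
    rewrite -(subnK (prime_gt1 p_pr)) addn2 !iterSr D1h.
    apply: tangent_iter_divides => //; have [[_ _ D1B] _] := tD1.
    by rewrite D1B //; apply: divides0.
  rewrite -(prednK (prime_gt0 p_pr)) iterSr.
  exact: tangent_iter_divides.
Qed.

End Closure.
End Derivations.

(** * Derivations of polynomial rings *)

Lemma divides0l (R : comNzRingType) (x : R) : divides 0 x -> x = 0.
Proof. by case=> q ->; rewrite mulr0. Qed.

Section Polynomials.
Variables (K : idomainType) (n p : nat).
Local Notation A := {mpoly K[n]}.
Local Notation B := (@subringB K n p).
Hypothesis charK : p \in [pchar K].
Implicit Types (x y z g : A).

Lemma subringBC c : B c%:MP.
Proof. by apply: adjoin_base; exists c. Qed.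

Lemma subringB1 : B 1.
Proof. by rewrite -mpolyC1; apply: subringBC. Qed.

Lemma subringBD x y : B x -> B y -> B (x + y).
Proof. exact: adjoin_add. Qed.

Lemma subringBN x : B x -> B (- x).
Proof. exact: adjoin_opp. Qed.

Lemma subringBM x y : B x -> B y -> B (x * y).
Proof. exact: adjoin_mul. Qed.

Lemma subringBX x k : B x -> B (x ^+ k).
Proof.
move=> Bx; elim: k => [|k IH]; first exact: subringB1.
by rewrite exprS; apply: subringBM.
Qed.

Lemma pchar_mpoly : p \in [pchar A].
Proof.
rewrite inE (pcharf_prime charK) /= -mpolyC_nat.
by rewrite (pcharf0 charK) mpolyC0.
Qed.

Lemma subringB_exp_char x : B (x ^+ p).
Proof.
elim/mpoly_ind_gen: x => [c|i|x y Bx By|x y Bx By].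
- exact/subringBX/subringBC.
- by apply: adjoin_gen; exists i.
- by rewrite exprDn_pchar ?pnatE ?pchar_mpoly ?(pcharf_prime charK) //; apply: subringBD.
- by rewrite exprMn; apply: subringBM.
Qed.

Lemma derivation_mderiv i : derivation B (mderiv i).
Proof.
have DM x y : (x * y)^`M(i) = x * y^`M(i) + y * x^`M(i).
  by rewrite mderivM addrC [x^`M(i) * _]mulrC.
split=> [||b]; [exact: mderivD | exact: DM|].
elim=> {b} [_ [c ->]|_ [j ->]|x _ Dx|x y _ Dx _ Dy|x y _ Dx _ Dy].
- exact: mderivC.
- rewrite mpolyXn mderivX mulmnE natrM (pcharf0 charK).
  by rewrite mulr0 scale0r.
- by rewrite mderivN Dx oppr0.
- by rewrite mderivD Dx Dy addr0.
- by rewrite DM Dx Dy !mulr0 addr0.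
Qed.

Lemma mderivXU i j : ('X_j : A)^`M(i) = (i == j)%:R.
Proof.
rewrite mderivX mnm1E eq_sym; case: eqP => [->|_]; last by rewrite scale0r.
rewrite scale1r [X in 'X_[X]](_ : _ = 0%MM) ?mpolyX0 //.
by apply/mnmP=> k; rewrite mnmBE subnn mnm0E.
Qed.

Lemma derivation_mpolyE D x : derivation B D ->
  D x = \sum_(i < n) D 'X_i * x^`M(i).
Proof.
case=> DD DM DB; elim/mpoly_ind_gen: x => [c|i|x y ex ey|x y ex ey].
- rewrite DB; last exact: subringBC.
  by rewrite big1 // => i _; rewrite mderivC mulr0.
- rewrite (bigD1 i) //= mderivXU eqxx mulr1 big1 ?addr0 // => j ji.
  by rewrite mderivXU (negbTE ji) mulr0.
- rewrite DD ex ey -big_split; apply: eq_bigr => i _.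
  by rewrite mderivD mulrDr.
- rewrite DM ex ey !big_distrr -big_split /=; apply: eq_bigr => i _.
  by rewrite mderivM; ring.
Qed.

(** The p-th iterate is again a derivation, and it vanishes on every variable because p is at least
    2. *)
Lemma iter_mderiv_char i x : iter p (mderiv i) x = 0.
Proof.
have dp := derivation_iter_char pchar_mpoly (derivation_mderiv i).
rewrite (derivation_mpolyE _ dp) big1 // => j _.
rewrite -(subnK (prime_gt1 (pcharf_prime charK))) addn2 !iterSr mderivXU.
rewrite -mpolyC_nat mderivC [X in X * _](_ : _ = 0) ?mul0r //.
by elim: (p - 2)%N => //= k ->; rewrite mderiv0.
Qed.

(** A monomial x^m of the support contributes m_i x^(m - U_i) to the i-th partial, so p divides
    every exponent m_i. *)
Lemma mderiv0_subringB x : (forall i, x^`M(i) = 0) -> B x.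
Proof.
move=> dx; rewrite [x]mpolyE big_seq_cond.
elim/big_rec: _ => [|m y]; first by rewrite -mpolyC0; apply: subringBC.
rewrite andbT mcoeff_msupp => xm By; apply: subringBD => //.
rewrite -mul_mpolyC; apply: subringBM; first exact: subringBC.
rewrite mpolyXE_id; elim/big_rec: _ => [|i z _ Bz]; first exact: subringB1.
apply: subringBM => //; have /dvdnP[q ->] : (p %| m i)%N; last first.
  by rewrite mulnC exprM; apply/subringBX/subringB_exp_char.
have [->|mi] := posnP (m i); first exact: dvdn0.
have /(congr1 (mcoeff (m - U_(i)))) := dx i.
rewrite mcoeff_mderiv mcoeff0 submK; last first.
  by apply/mnm_lepP=> j; rewrite mnm1E; case: eqP => [<-|].
rewrite mnmBE mnm1E eqxx subn1 prednK // -mulr_natr => /eqP.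
by rewrite mulf_eq0 (negbTE xm) /= -(dvdn_pcharf charK).
Qed.

(** * Reduction to B modulo an ideal stable under the partial derivatives *)

Section StableIdeal.
Variable J : A -> Prop.
Hypotheses (J0 : J 0) (JD : forall x y, J x -> J y -> J (x + y))
  (JM : forall x y, J y -> J (x * y)) (JS : forall i x, J x -> J x^`M(i)).

Lemma stable_iter_mderiv i k x : J x -> J (iter k (mderiv i) x).
Proof. by move=> Jx; elim: k => //= k; apply: JS. Qed.

(** The terms of positive degree in the Taylor expansion in x_i have iterated partials of [y] as
    coefficients, so they lie in [J]; they are subtracted from the top down. The last conclusion
    lets the variables be treated in turn. *)
Lemma kill_mderiv i k y : (k < p)%N -> J y^`M(i) -> iter k.+1 (mderiv i) y = 0 ->
  exists z, [/\ J (y - z), z^`M(i) = 0 & forall j, y^`M(j) = 0 -> z^`M(j) = 0].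
Proof.
elim: k y => [|k IH] y kp Jy yk.
  by exists y; rewrite subrr.
have u := fact_unit pchar_mpoly kp.
have dD := derivation_mderiv i.
set c := iter k.+1 (mderiv i) y in yk.
have Dc : c^`M(i) = 0 by [].
have Jc : J c by rewrite /c iterSr; apply: stable_iter_mderiv.
pose b : A := (k.+1`!%:R)^-1 * 'X_i ^+ k.+1.
have DbM l x : iter l (mderiv i) (k.+1`!%:R * x) = k.+1`!%:R * iter l (mderiv i) x.
  elim: l => //= l ->; case: dD => _ -> DB.
  by rewrite [X in _ + _ * X]DB ?mulr0 ?addr0 // -mpolyC_nat; apply: subringBC.
have bc : iter k.+1 (mderiv i) (b * c) = c.
  (* With 0 in place of [g], the congruence of [iter_derivation_power] becomes an equality; it is
     applied to x_i with [w] equal to 1. *)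
  have t0 : tangent B 0 (mderiv i) by split=> //; rewrite mderiv0; apply: divides0.
  have := @iter_derivation_power _ _ 0 (mderiv i) k.+1 'X_i 1 c t0.
  rewrite mderivXU eqxx subrr Dc -mpolyC1 mderivC mpolyC1 expr1n mulr1.
  move=> /(_ erefl (divides0 _) (divides0 _))/divides0l/eqP; rewrite subr_eq0 => /eqP e.
  apply: (mulrI u); rewrite -DbM -e; congr (iter _ _ _).
  by rewrite /b mulrA mulrA divrr ?mul1r.
have [||z [Jz Dz yz]] := IH (y - b * c) (ltnW kp).
- by rewrite mderivB -mulN1r; apply/JD/JM/JS/JM.
- have iterB x z :
      iter k.+1 (mderiv i) (x - z) = iter k.+1 (mderiv i) x - iter k.+1 (mderiv i) z.
    by elim: (k.+1) => //= l ->; rewrite mderivB.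
  by rewrite iterB bc subrr.
exists z; split=> //; first by rewrite -[y](subrK (b * c)) addrAC; apply/JD/JM.
move=> j yj; have [->//|ji] := eqVneq j i; apply: yz.
have cj : c^`M(j) = 0.
  rewrite /c; elim: (k.+1) => //= l e.
  by rewrite mderiv_comm e mderiv0.
have [_ DM DB] := derivation_mderiv j.
have DX : ('X_i ^+ k.+1 : A)^`M(j) = 0.
  by rewrite (derivationXn (derivation_mderiv j)) mderivXU (negbTE ji) mulr0.
have Db : b^`M(j) = 0.
  apply: (mulrI u); rewrite mulr0.
  have := DX; rewrite -['X_i ^+ _](mulVKr u) -/b DM.
  by rewrite (DB _%:R) ?mulr0 ?addr0 // -mpolyC_nat; apply: subringBC.
by rewrite mderivB yj DM cj Db !mulr0 addr0 subr0.
Qed.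

Lemma mderiv_stable_subringB y : (forall i, J y^`M(i)) ->
  exists c, B c /\ J (y - c).
Proof.
move=> Jy.
suff [z [Jz Dz]] : exists z, J (y - z) /\ forall i, i \in enum 'I_n -> z^`M(i) = 0.
  by exists z; split=> //; apply: mderiv0_subringB => i; apply: Dz; rewrite mem_enum.
elim: (enum 'I_n) => [|i s [z [Jz Dz]]]; first by exists y; rewrite subrr.
have p_gt0 := prime_gt0 (pcharf_prime charK).
have [|||z' [Jz' Dz' zz']] := @kill_mderiv i p.-1 z.
- by rewrite prednK.
- rewrite -[z](subKr y) mderivB -mulN1r; apply/JD/JM/JS => //.
- by rewrite prednK // iter_mderiv_char.
exists z'; split; first by rewrite -[y](subrK z) -addrA; apply: JD.
by move=> j; rewrite inE => /orP[/eqP->//|/Dz/zz'].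
Qed.

End StableIdeal.

(** A partial derivative of a nonzero [g] has smaller total degree than [g]. *)
Lemma divides_mderiv_eq0 g i : divides g g^`M(i) -> g^`M(i) = 0.
Proof.
case=> q e; apply/eqP; apply: contraTT isT => dg0.
have q0 : q != 0 by apply: contraNneq dg0 => q0; rewrite e q0 mul0r.
have g0 : g != 0 by apply: contraNneq dg0 => g0; rewrite g0 mderiv0.
have : (msize g <= msize g^`M(i))%N.
  by rewrite e msizeM // (mpolySpred _ q0) addSn leq_addl.
rewrite leqNgt => /negP; case.
apply: leq_ltn_trans (_ : (msize g).-1 < _)%N; last first.
  by rewrite prednK // lt0n msize_poly_eq0.
rewrite msizeE big_seq_cond; elim/big_rec: _ => // m k.
rewrite andbT mcoeff_msupp mcoeff_mderiv => gm kg.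
rewrite geq_max kg andbT.
have : (m + U_(i))%MM \in msupp g.
  by rewrite mcoeff_msupp; apply: contraNneq gm => ->; rewrite mul0rn.
by move/msize_mdeg_lt; rewrite mdegD mdeg1 addn1; case: (msize g).
Qed.

Lemma tangent_const0_frac_adjoin g y : prime_elt g ->
  tangent_const B g [::] y -> frac_adjoin B g [::] y.
Proof.
move=> gpr yconst; have [_ _ gP] := gpr.
have toJ Y b : B b -> ~ divides g b -> divides g (Y - b * y) ->
   (exists c, B c /\ divides g (Y - c)) -> frac_adjoin B g [::] y.
  move=> Bb gb gY [c [Bc gc]]; exists b, c; split=> //; first exact: adjoin_base.
  by rewrite (_ : _ - _ = (Y - c) - (Y - b * y)); [apply: dividesB | ring].
have [Bg|nBg] := classic (B g).
  apply: (toJ y 1); first exact: subringB1.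
  - exact/unit_notdivides/unitr1.
  - by rewrite mul1r subrr; apply: divides0.
  (* For [g] in [B] every partial derivative is tangent, so the ideal of [g] is itself stable. *)
  have tD i : tangent B g (mderiv i).
    split; first exact: derivation_mderiv.
    by case: (derivation_mderiv i) => _ _ ->//; apply: divides0.
  apply: mderiv_stable_subringB => [|x z|x z|i x|i].
  - exact: divides0.
  - exact: dividesD.
  - exact: dividesMl.
  - exact: tangent_divides.
  - exact: yconst.
have [i gi] : exists i, ~ divides g g^`M(i).
  apply: NNPP => h; apply: nBg; apply: mderiv0_subringB => i.
  by apply: divides_mderiv_eq0; apply: NNPP => gi; apply: h; exists i.
set w := g^`M(i) in gi.
(* [Y] is congruent to [b * y] by [iter_derivation_top], and its i-th partial is zero because the
   p-th iterate of a partial is zero. *)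
pose Y := iter p.-1 (mderiv i) (g ^+ p.-1 * (w * y)).
pose b : A := p.-1`!%:R * w ^+ p.
have p_gt0 := prime_gt0 (pcharf_prime charK).
have Bb : B b.
  apply: subringBM; last exact: subringB_exp_char.
  by rewrite -mpolyC_nat; apply: subringBC.
have gb : ~ divides g b.
  apply: prime_notdividesM => //; last exact: prime_not_dividesX.
  by apply/unit_notdivides/(fact_unit pchar_mpoly); rewrite ?prednK.
have gY : divides g (Y - b * y).
  have := iter_derivation_top p.-1 g (w * y) (derivation_mderiv i).
  rewrite -/Y -/w; congr (divides g (Y - _)).
  have -> : b = p.-1`!%:R * (w ^+ p.-1 * w) by rewrite -exprSr prednK.
  by rewrite !mulrA.
have Yi : Y^`M(i) = 0.
  have := iter_mderiv_char i (g ^+ p.-1 * (w * y)).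
  by rewrite -[in iter _](prednK p_gt0).
(* This combination kills [g]; on polynomials with zero i-th partial it is [w] times the l-th
   partial. *)
pose D l x := w * x^`M(l) + (- g^`M(l)) * x^`M(i).
have tD l : tangent B g (D l).
  split; first by apply: derivation_lin; apply: derivation_mderiv.
  by rewrite /D mulNr [w * _]mulrC subrr; apply: divides0.
have gD l Z : Z^`M(i) = 0 -> divides g (D l Z) -> divides g Z^`M(l).
  by move=> Zi; rewrite /D Zi mulr0 addr0 => /gP[].
apply: (toJ Y b) => //.
(* The largest ideal inside that of [g] that is stable under all partials. *)
pose J x := forall s, divides g (foldl (fun z l => z^`M(l)) x s).
have foldlD s x z : foldl (fun z l => z^`M(l)) (x + z) s =
    foldl (fun z l => z^`M(l)) x s + foldl (fun z l => z^`M(l)) z s.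
  by elim: s x z => //= l s IH x z; rewrite mderivD IH.
have [|x z Jx Jz s|x z Jz s|l x Jx s|l s|c [Bc Jc]] := @mderiv_stable_subringB J _ _ _ _ Y.
- elim=> [|l s IH] /=; first exact: divides0.
  by rewrite mderiv0.
- by rewrite foldlD; apply: dividesD.
- elim: s x z Jz => [|l s IH] x z Jz /=; first exact: dividesMl (Jz [::]).
  rewrite mderivM foldlD; apply: dividesD; first exact: IH.
  by apply: IH => t; apply: (Jz (l :: t)).
- exact: (Jx (l :: s)).
(* All iterated partials of [Y] have zero i-th partial, so [gD] carries divisibility by [g] from one
   to the next. *)
- have : divides g Y^`M(l).
    apply: gD => //; rewrite -[Y](subrK (b * y)).
    have [[DD DM DB] _] := tD l.
    rewrite DD DM (DB b Bb) mulr0 addr0; apply: dividesD.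
      exact: tangent_divides.
    by apply/dividesMl/yconst.
  have : Y^`M(l)^`M(i) = 0 by rewrite mderiv_comm Yi mderiv0.
  move: (Y^`M(l)); elim: s => //= j s IH Z Zi gZ.
  apply: IH; first by rewrite mderiv_comm Zi mderiv0.
  by apply: gD => //; apply: tangent_divides.
- by exists c; split=> //; apply: (Jc [::]).
Qed.

Lemma tangent_const_subringB_frac_adjoin g S y : prime_elt g ->
  tangent_const B g S y -> frac_adjoin B g S y.
Proof.
move=> gpr; apply: (tangent_const_frac_adjoin pchar_mpoly) => //.
- exact: subringB1.
- exact: subringBD.
- exact: subringBN.
- exact: subringBM.
- exact: subringB_exp_char.
- by move=> z; apply: tangent_const0_frac_adjoin.
Qed.

End Polynomials.

(** * Jacobian determinants modulo a prime *)

Lemma prime_divides_bigprod (R : idomainType) (I : finType) (F : I -> R) (x : R) :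
  prime_elt x -> divides x (\prod_i F i) -> exists i, divides x (F i).
Proof.
move=> xpr; rewrite -(big_map F predT id) => /(prime_divides_prod xpr)[_ /mapP[i _ ->]].
by exists i.
Qed.

(** A nonidentity permutation moves at least two indices, hence one other than [i], whose factor is
    divisible by [g]. *)
Lemma det_one_row_diag (R : comNzRingType) m (T : 'M[R]_m) (g : R) (i : 'I_m) :
  (forall r k, r != i -> k != r -> divides g (T r k)) ->
  divides g (\det T - \prod_r T r r).
Proof.
move=> Tg; rewrite /determinant (bigD1 (1%g : {perm 'I_m})) //= odd_perm1 expr0 mul1r.
under [X in X + _ - _]eq_bigr => r _ do rewrite perm1.
rewrite addrAC subrr add0r; apply: divides_sum => s s1; apply: dividesMl.
have [r ri sr] : exists2 r, r != i & s r != r.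
  apply: NNPP => h; case/eqP: s1; apply/permP => r; rewrite perm1.
  have fix_s k : k != i -> s k = k.
    by move=> ki; apply/eqP/negPn/negP => sk; apply: h; exists k.
  have [->|/fix_s//] := eqVneq r i.
  have [//|si] := eqVneq (s i) i; exact: (perm_inj (fix_s _ si)).
by rewrite (bigD1 r) //=; apply/dividesMr/Tg.
Qed.

Section Main.
Variables (K : idomainType) (n p m : nat) (f : 'I_m -> {mpoly K[n]}).
Local Notation A := {mpoly K[n]}.
Local Notation B := (@subringB K n p).
Hypothesis charK : p \in [pchar K].
Implicit Types (P : pred 'I_m) (g b c : A) (D : A -> A).

(** Common form of [subringR] and [subringR2], with [P] selecting the indices that are kept. *)
Definition subring_gen P : A -> Prop :=
  adjoin B (fun h : A => exists2 k : 'I_m, P k & h = f k).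

(** The s_k are the formal partials of a polynomial expression of [c] in the f_k over [B]; the same
    s_k serve all derivations. *)
Lemma chain_rule P c : subring_gen P c ->
  exists s : 'I_m -> A, (forall k, ~~ P k -> s k = 0) /\
    forall D, derivation B D -> D c = \sum_k s k * D (f k).
Proof.
elim=> {c} [c Bc|_ [k Pk ->]|x _ [s [sP sD]]|x y _ [s [sP sD]] _ [t [tP tD]]
           |x y _ [s [sP sD]] _ [t [tP tD]]].
- exists (fun=> 0); split=> // D [_ _ ->//].
  by rewrite big1 // => k _; rewrite mul0r.
- exists (fun j => (j == k)%:R); split=> [j|D dD].
    by case: eqP => // ->; rewrite Pk.
  rewrite (bigD1 k) //= eqxx mul1r big1 ?addr0 // => j /negbTE->.
  by rewrite mul0r.
- exists (fun k => - s k); split=> [k /sP->|D dD]; first by rewrite oppr0.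
  rewrite (derivationN dD) sD // -sumrN.
  by apply: eq_bigr => k _; rewrite mulNr.
- exists (fun k => s k + t k); split=> [k Pk|D dD]; first by rewrite sP ?tP ?addr0.
  case: (dD) => -> _ _; rewrite sD // tD // -big_split.
  by apply: eq_bigr => k _; rewrite mulrDl.
- exists (fun k => x * t k + y * s k); split=> [k Pk|D dD].
    by rewrite sP ?tP // !mulr0 addr0.
  case: (dD) => _ -> _; rewrite sD // tD // !big_distrr -big_split.
  by apply: eq_bigr => k _ /=; ring.
Qed.

(** As [b] and [c] are written without f_i, the coefficient at [i] is [b] itself, which makes the
    relation nontrivial modulo [g]. *)
Lemma chain_rule_affine P i b c : ~~ P i -> subring_gen P b -> subring_gen P c ->
  exists s : 'I_m -> A, [/\ s i = b, forall k, k != i -> ~~ P k -> s k = 0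
    & forall D, derivation B D -> D (b * f i + c) = \sum_k s k * D (f k)].
Proof.
move=> Pi /chain_rule[s [sP sD]] /chain_rule[t [tP tD]].
exists (fun k => (k == i)%:R * b + f i * s k + t k); split=> [|k ki Pk|D dD].
- by rewrite eqxx sP // tP // mulr0 !addr0 mul1r.
- by rewrite (negbTE ki) sP // tP // mul0r mulr0 !addr0.
- case: (dD) => -> -> _; rewrite sD // tD //.
  under [RHS]eq_bigr => k _ do rewrite !mulrDl -[f i * _ * _]mulrA.
  rewrite !big_split /= -big_distrr /=; congr (_ + _ + _).
  rewrite (bigD1 i) //= eqxx mul1r big1 ?addr0 // => k /negbTE->.
  by rewrite !mul0r.
Qed.

(** The row [s] times the Jacobian matrix vanishes modulo [g]; multiplying by the adjugate gives
    that [g] divides the determinant times s_i. *)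
Lemma relation_divides_jac g (s : 'I_m -> A) i : prime_elt g -> ~ divides g (s i) ->
  (forall l, divides g (\sum_k s k * (f k)^`M(l))) -> forall j, divides g (jac f j).
Proof.
move=> [_ _ gP] si srel j; rewrite /jac; set M := (X in \det X).
pose v : 'rV[A]_m := \row_k s k.
have vM l : divides g ((v *m M) 0 l).
  by rewrite mxE; under eq_bigr => k _ do rewrite !mxE.
suff /gP[]// : divides g (\det M * s i) by [].
have -> : \det M * s i = (v *m M *m \adj M) 0 i.
  by rewrite -mulmxA mul_mx_adj mul_mx_scalar !mxE.
by rewrite mxE; apply: divides_sum => l _; apply: dividesMr.
Qed.

(** Writing each D_r through the partials and expanding by multilinearity, as in Cauchy-Binet, makes
    the determinant a combination of the minors [jac f j]. *)
Lemma det_derivations_divides g (D : 'I_m -> A -> A) :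
  (forall r, derivation B (D r)) -> (forall j, divides g (jac f j)) ->
  divides g (\det (\matrix_(r, k) D r (f k))).
Proof.
move=> dD gj; rewrite /determinant.
under eq_bigr => s _.
  under eq_bigr => r _ do rewrite mxE (derivation_mpolyE _ (dD r)).
  rewrite bigA_distr_bigA big_distrr /=; over.
rewrite exchange_big; apply: divides_sum => j _ /=.
rewrite [X in divides g X](_ : _ = (\prod_r D r 'X_(j r)) * jac f j).
  exact: dividesMl.
rewrite /jac -det_tr /determinant big_distrr; apply: eq_bigr => s _ /=.
rewrite big_split mulrCA; congr (_ * (_ * _)).
by apply: eq_bigr => r _; rewrite !mxE.
Qed.

Lemma tangent_annihilated_adjoin g P y : prime_elt g ->
  (forall D, tangent B g D -> (forall k, P k -> divides g (D (f k))) -> divides g (D y)) ->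
  exists b c, [/\ subring_gen P b, subring_gen P c, ~ divides g b & divides g (b * y + c)].
Proof.
move=> gpr yP.
have [|b [c [Bb gb Sc e]]] :=
    @tangent_const_subringB_frac_adjoin K n p charK g [seq f k | k <- enum P] y gpr.
  move=> D tD DS; apply: yP => // k Pk; apply: DS.
  by apply: map_f; rewrite mem_enum.
exists b, (- c); split=> //; first exact: adjoin_base.
apply: adjoin_opp; apply: adjoin_mono Sc => z /mapP[k].
by rewrite mem_enum => Pk ->; apply adjoin_gen; exists k.
Qed.

End Main.

(** * The criterion for divisibility of the differential gcd by g *)

Theorem theorem3p6 (K : idomainType) (p n m : nat)
    (ufdK : is_UFD K) (charK : p \in [pchar K])
    (n_gt0 : (0 < n)%N) (m_gt0 : (0 < m)%N)
    (f : 'I_m -> {mpoly K[n]}) (g : {mpoly K[n]})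
    (g_irr : irreducible_elt g)
    (d : {mpoly K[n]}) (dgcd_d : is_dgcd f d) :
  divides g d <->
  [\/ ~ subringB p g /\
      (exists (i : 'I_m) (b c : {mpoly K[n]}),
         [/\ subringR f p i b, subringR f p i c,
             ~ divides g b & divides (g ^+ 2) (b * f i + c)]),
      subringB p g /\
      (exists (i : 'I_m) (b c : {mpoly K[n]}),
         [/\ subringR f p i b, subringR f p i c,
             ~ divides g b & divides g (b * f i + c)])
    | exists (i j : 'I_m) (b1 b2 c1 c2 : {mpoly K[n]}),
        [/\ i != j,
            [/\ subringR2 f p i j b1, subringR2 f p i j b2,
                subringR2 f p i j c1 & subringR2 f p i j c2],
            ~ divides g b1 /\ ~ divides g b2,
            divides g (b1 * f i + c1) & divides g (b2 * f j + c2)]].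
Proof.
have gpr : prime_elt g.
  apply: prime_factorial_irreducible g_irr.
  exact/mpoly_prime_factorial/UFD_prime_factorial.
have [_ _ gP] := gpr.
have [d_jac d_max] := dgcd_d.
pose B := @subringB K n p.
have dder l : derivation B (mderiv l) := derivation_mderiv charK l.
split=> [gd|cond]; last first.
  apply: d_max.
  have [[_ [i [b [c [Rb Rc gb gbc]]]]]|[Bg [i [b [c [Rb Rc gb gbc]]]]]
      |[i [j [b1 [b2 [c1 [c2 [ij [Rb1 Rb2 Rc1 Rc2] [gb1 gb2] gi gj]]]]]]]] := cond.
  - have [|s [si _ sD]] := @chain_rule_affine K n p m f [pred k | k != i] i b c _ Rb Rc.
      by rewrite /= eqxx.
    apply: (@relation_divides_jac _ _ _ f g s i) => // [|l]; first by rewrite si.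
    rewrite -sD //; case: gbc => q ->; case: (dder l) => _ DM _.
    by exists (g * q^`M(l) + q * g^`M(l) + q * g^`M(l)); rewrite !DM; ring.
  - have [|s [si _ sD]] := @chain_rule_affine K n p m f [pred k | k != i] i b c _ Rb Rc.
      by rewrite /= eqxx.
    apply: (@relation_divides_jac _ _ _ f g s i) => // [|l]; first by rewrite si.
    rewrite -sD //; apply: (tangent_divides (B := B)) gbc; split=> //.
    by case: (dder l) => _ _ ->//; apply: divides0.
  - pose P := [pred k | (k != i) && (k != j)].
    have [|s [si sP sD]] := @chain_rule_affine K n p m f P i b1 c1 _ Rb1 Rc1.
      by rewrite /= eqxx.
    have [|t [tj tP tD]] := @chain_rule_affine K n p m f P j b2 c2 _ Rb2 Rc2.
      by rewrite /= eqxx andbF.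
    case: gi => h1 e1; case: gj => h2 e2.
    have es l : \sum_k s k * (f k)^`M(l) = h1 * g^`M(l) + g * h1^`M(l).
      by rewrite -sD // e1; case: (dder l) => _ DM _; rewrite DM.
    have et l : \sum_k t k * (f k)^`M(l) = h2 * g^`M(l) + g * h2^`M(l).
      by rewrite -tD // e2; case: (dder l) => _ DM _; rewrite DM.
    have [gh1|gh1] := classic (divides g h1).
      apply: (@relation_divides_jac _ _ _ f g s i) => // [|l]; first by rewrite si.
      rewrite es; apply: dividesD; apply: dividesMr => //.
      exact: divides_refl.
    (* The combination cancels the gradient of [g]. Its coefficient at [j] is -h1 b2, as s_j is
       zero, and [g] divides neither factor. *)
    apply: (@relation_divides_jac _ _ _ f g (fun k => h2 * s k - h1 * t k) j) => // [|l].
      rewrite sP 1?eq_sym //= ?eqxx ?andbF // mulr0 sub0r tj.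
      by move=> /dividesN; rewrite opprK; apply: prime_notdividesM.
    under eq_bigr => k _ do rewrite mulrBl -!mulrA.
    rewrite sumrB -!big_distrr /= es et.
    by exists (h2 * h1^`M(l) - h1 * h2^`M(l)); ring.
have gjac j : divides g (jac f j) by apply: divides_trans gd (d_jac j).
have [i iP] : exists i, forall D, tangent B g D ->
    (forall k, k != i -> divides g (D (f k))) -> divides g (D (f i)).
  apply: NNPP => noi.
  have /fin_all_exists[D DP] : forall i, exists D, [/\ tangent B g D,
     forall k, k != i -> divides g (D (f k)) & ~ divides g (D (f i))].
    move=> i; apply: NNPP => noD; apply: noi; exists i => D tD Dk.
    by apply: NNPP => Di; apply: noD; exists D.
  have gdet : divides g (\det (\matrix_(r, k) D r (f k))).
    by apply: (det_derivations_divides (p := p)) => // r; case: (DP r) => [[]].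
  have : divides g (\prod_r (\matrix_(r, k) D r (f k)) r r).
    apply: (iffLR (divides_congr _)) gdet.
    (* All rows are diagonal modulo [g], so any index can be the exceptional row; [m_gt0] supplies
       one. *)
    apply: (det_one_row_diag (i := Ordinal m_gt0)) => r k _ kr.
    by rewrite mxE; case: (DP r) => _ Dr _; apply: Dr.
  by case/(prime_divides_bigprod gpr) => r; rewrite mxE; case: (DP r).
have [b [c [Rb Rc gb gbc]]] :=
  tangent_annihilated_adjoin (P := [pred k | k != i]) charK gpr iP.
have [Bg|nBg] := classic (B g); first by apply: Or32; split=> //; exists i, b, c.
have [h eh] := gbc.
have [gh|gh] := classic (divides g h).
  apply: Or31; split=> //; exists i, b, c; split=> //.
  by case: gh => q eq; exists q; rewrite eh eq; ring.
have [l0 gl0] : exists l, ~ divides g g^`M(l).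
  apply: NNPP => h'; apply: nBg; apply: (mderiv0_subringB charK) => l.
  by apply: divides_mderiv_eq0; apply: NNPP => gl; apply: h'; exists l.
have [j [ji jP]] : exists j, j != i /\ forall D, tangent B g D ->
    (forall k, (k != i) && (k != j) -> divides g (D (f k))) -> divides g (D (f j)).
  apply: NNPP => noj.
  have /fin_all_exists[D DP] : forall j, exists D, [/\ derivation B D,
      j = i -> ~ divides g (D g) &
      j != i -> [/\ divides g (D g), forall k, (k != i) && (k != j) -> divides g (D (f k))
        & ~ divides g (D (f j))]].
    move=> j; have [->|ji] := eqVneq j i; first by exists (mderiv l0).
    apply: NNPP => noD; apply: noj; exists j; split=> // D [dD Dg] Dk.
    by apply: NNPP => Dj; apply: noD; exists D; split=> // /eqP; rewrite (negbTE ji).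
  have dD r : derivation B (D r) by case: (DP r).
  pose N := \matrix_(r, k) D r (f k).
  have [|s [si _ sD]] := @chain_rule_affine K n p m f [pred k | k != i] i b c _ Rb Rc.
    by rewrite /= eqxx.
  pose Q : 'M[{mpoly K[n]}]_m := \matrix_(k, l) if l == i then s k else (k == l)%:R.
  (* Column [i] of [N *m Q] consists of the [D r (b * f i + c) = D r (h * g)]. *)
  have NQi r : (N *m Q) r i = h * D r g + g * D r h.
    case: (dD r) => _ DM _; rewrite -DM -eh sD // mxE; apply: eq_bigr => k _.
    by rewrite !mxE eqxx mulrC.
  have NQl r l : l != i -> (N *m Q) r l = D r (f l).
    move=> li; rewrite mxE (bigD1 l) //= big1 => [|k kl].
      by rewrite !mxE (negbTE li) eqxx mulr1 addr0.
    by rewrite !mxE (negbTE li) (negbTE kl) mulr0.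
  have gdet : divides g (\det (N *m Q)).
    by rewrite det_mulmx; apply/dividesMr/(det_derivations_divides (p := p)).
  have : divides g (\prod_r (N *m Q) r r).
    apply: (iffLR (divides_congr _)) gdet.
    (* Row [i] is exceptional. In the others, column [i] holds h D_r g + g D_r h, divisible by [g]
       because D_r is tangent. *)
    apply: (det_one_row_diag (i := i)) => r k ri kr.
    have [_ _ /(_ ri)[Dg Dk _]] := DP r.
    have [->|ki] := eqVneq k i.
      by rewrite NQi; apply: dividesD; [apply: dividesMl | apply/dividesMr/divides_refl].
    by rewrite NQl //; apply: Dk; rewrite ki kr.
  case/(prime_divides_bigprod gpr) => r; have [ri|ri] := eqVneq r i.
    (* Modulo [g] this diagonal entry is h D_i g, and [g] divides neither factor. *)
    rewrite ri NQi => /dividesB/(_ (dividesMr (D i h) (divides_refl g))).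
    by rewrite addrK => /gP[//|]; case: (DP i) => _ + _; apply.
  by rewrite NQl //; case: (DP r) => _ _ /(_ ri)[].
apply: Or33.
have [|b1 [c1 [Rb1 Rc1 gb1 g1]]] := tangent_annihilated_adjoin
    (f := f) (P := [pred k | (k != i) && (k != j)]) (y := f i) charK gpr.
  (* A tangent [D] killing the remaining f_k kills f_j by [jP], and then f_i by [iP]. *)
  move=> D tD Dk; apply: iP => // k ki; have [->|kj] := eqVneq k j; first exact: jP.
  by apply: Dk; rewrite /= ki.
have [b2 [c2 [Rb2 Rc2 gb2 g2]]] :=
  tangent_annihilated_adjoin (P := [pred k | (k != i) && (k != j)]) charK gpr jP.
by exists i, j, b1, b2, c1, c2; rewrite eq_sym.
Qed.
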